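(* The fully discrete compact difference scheme for the beam problem described in the context, with solution $U^n,V^n$ $(0\le n\le N+1)$, satisfies the energy dissipative property $$0\le\hat{\mathbf E}^n\le\hat{\mathbf E}^0,\qquad 1\le n\le N,$$ where $$\hat{\mathbf E}^n:=\sqrt{\|\mathscr A\delta_tU^{n+1}\|^2+\tfrac12\left(\|\mathscr AV^{n+1}\|^2+\|\mathscr AV^n\|^2\right)}.$$
   Context: Beam problem: with $v=\partial_x^2u$, $$\partial_t^2u+\hat q(t)\partial_tu+\partial_x^2v=f(x,t),\quad (x,t)\in[0,1]\times(0,T],\qquad \hat q(t)=P\Big(\int_0^1|\partial_x^2u(x,t)|^2dx\Big),$$ $u(x,0)=u_0(x)$, $\partial_tu(x,0)=u_1(x)$ for $x\in[0,1]$, and $u(0,t)=u(1,t)=v(0,t)=v(1,t)=0$ for $t\in(0,T]$; $u_0,u_1,f$ are given functions. $\mathcal Q$ denotes a generic positive constant independent of the mesh sizes, possibly different in different places. Standing assumptions on $P:\mathbb R^+\to(0,\infty)$: (i) there are positive constants $p_0,p_1$ such that $P(z)\le p_1$ for $0\le z\le\mathcal Q$ and $P(z)\ge p_0$ for all $z\ge0$; (ii) $P$ is continuously differentiable with $0\le P'(z)\le L$ for $z\ge0$, where $L$ is the Lipschitz constant. Standing regularity assumption: $|\partial_t^4u|\le\mathcal Q$, $|\partial_t^3\partial_x^2u|\le\mathcal Q$, $|\partial_x^6u|\le\mathcal Q$ and $|\partial_x^4u_1|\le\mathcal Q$ on $[0,1]\times[0,T]$. Grid: $J$ a positive integer, $h=1/(2J)$,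 $x_j=jh$, $0\le j\le2J$; $t_n=n\tau$, $0\le n\le N+1$, a uniform partition of $[0,T]$ with $\tau=T/(N+1)$. For grid functions: $\delta_x\delta_{\bar x}U_j=(U_{j+1}-2U_j+U_{j-1})/h^2$; $\mathscr AU_j=\frac{1}{12}(U_{j+1}+10U_j+U_{j-1})$ for $1\le j\le2J-1$ and $\mathscr AU_j=U_j$ for $j=0,2J$; $\delta_tU^n_j=(U^n_j-U^{n-1}_j)/\tau$; $\delta_t^{(2)}U^n_j=(U^{n+1}_j-2U^n_j+U^{n-1}_j)/\tau^2$; $\bar\delta_tU^n_j=(U^{n+1}_j-U^{n-1}_j)/(2\tau)$; $\widetilde U^n_j=(U^{n+1}_j+U^{n-1}_j)/2$. Norms: $\|Q\|^2=h\sum_{j=1}^{2J-1}Q_j^2$, $\|Q\|_A^2=2h\sum_{j=1}^JQ_{2j-1}^2$, $\|Q\|_B^2=\frac23\|Q\|^2+\frac13\|Q\|_A^2$. Grid functions vanishing at the boundary are identified with the vectors of their interior values, $U^n=[U_1^n,\dots,U_{2J-1}^n]^\top$, $V^n=[V_1^n,\dots,V_{2J-1}^n]^\top$. Fully discrete scheme, for $1\le j\le2J-1$ and $1\le n\le N$, with $f_j^n=f(x_j,t_n)$: $$\mathscr A\delta_t^{(2)}U_j^n+P(\|V^n\|_B^2)\,\mathscr A\bar\delta_tU_j^n+\delta_x\delta_{\bar x}\widetilde V_j^n=\mathscr Af_j^n,\qquad \mathscr A\bar\delta_tV_j^n=\delta_x\delta_{\bar x}\bar\delta_tU_j^n,$$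 with $U_0^n=U_{2J}^n=V_0^n=V_{2J}^n=0$ for $0\le n\le N+1$, and initial data $U_j^0=u_0(x_j)$, $\delta_tU_j^1=u_1(x_j)+\frac\tau2u_2(x_j)$, where $u_2=\partial_t^2u(\cdot,0)=-\hat q(0)u_1-\partial_x^4u_0+f(\cdot,0)$; and $V^0=\Delta U^0$, $V^1=\Delta U^1$, that is, $V_j^0=(\partial_x^2u_0)(x_j)$, $V_j^1=\partial_x^2\big(u_0+\tau u_1+\frac{\tau^2}2u_2\big)(x_j)$ for $1\le j\le 2J-1$.
   Formalization: The formal theorem assumes that the forcing f vanishes on [0,1]×(0,T]; for a general f the claimed inequality is false (e.g. P constant, u = t^4 sin(πx), where the energy is 0 at n = 0 and positive at n = 1). *)

(* Defs.v *)
From Stdlib Require Import Reals Arith.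
From Coquelicot Require Import Coquelicot.

Open Scope R_scope.

(* Stdlib [Reals] with Coquelicot's [RInt] and [sum_n_m].

   All functions of the continuous problem live on closed intervals, so every
   derivative below is the derivative relative to the domain ([D_in]), hence
   one-sided at the end points; nothing is assumed outside the domain. *)

Definition itv (a b : R) : R -> Prop := fun x => a <= x <= b.
Definition nonneg_half_line : R -> Prop := fun z => 0 <= z.

(* [gn] is the [n]-th derivative of [g] on [D]; in particular the lower
   derivatives exist on [D]. *)
Fixpoint nth_deriv_on (D : R -> Prop) (n : nat) (g gn : R -> R) : Prop :=
  match n with
  | O => forall x, D x -> gn x = g x
  | S m => exists g1 : R -> R,
      (forall x, D x -> D_in g g1 D x) /\ nth_deriv_on D m g1 gn
  end.

(* Functions of [(x, t)] on [[0,1] x [0,T]] take [x] first. *)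
Definition is_dx (T : R) (n : nat) (w wn : R -> R -> R) : Prop :=
  forall t, itv 0 T t ->
    nth_deriv_on (itv 0 1) n (fun x => w x t) (fun x => wn x t).

Definition is_dt (T : R) (n : nat) (w wn : R -> R -> R) : Prop :=
  forall x, itv 0 1 x -> nth_deriv_on (itv 0 T) n (w x) (wn x).

(* [Q] is the constant delimiting the range on which [P] is bounded by [p1]. *)
Definition damping_assumptions (P : R -> R) (Q p0 p1 L : R) : Prop :=
  0 < Q /\ 0 < p0 /\ 0 < p1 /\
  (forall z, 0 <= z -> 0 < P z) /\
  (forall z, 0 <= z <= Q -> P z <= p1) /\
  (forall z, 0 <= z -> p0 <= P z) /\
  (exists dP : R -> R,
     (forall z, 0 <= z -> D_in P dP nonneg_half_line z) /\
     (forall z, 0 <= z -> continue_in dP nonneg_half_line z) /\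
     (forall z, 0 <= z -> 0 <= dP z <= L)).

Definition qhat (P : R -> R) (v : R -> R -> R) (t : R) : R :=
  P (RInt (fun x => Rabs (v x t) ^ 2) 0 1).

Definition beam_solution (P : R -> R) (f : R -> R -> R) (u0 u1 : R -> R)
    (T : R) (u : R -> R -> R) : Prop :=
  exists ut utt v vxx : R -> R -> R,
    is_dt T 1 u ut /\ is_dt T 2 u utt /\ is_dx T 2 u v /\ is_dx T 2 v vxx /\
    (forall x t, 0 <= x <= 1 -> 0 < t <= T ->
       utt x t + qhat P v t * ut x t + vxx x t = f x t) /\
    (forall x, 0 <= x <= 1 -> u x 0 = u0 x /\ ut x 0 = u1 x) /\
    (forall t, 0 < t <= T -> u 0 t = 0 /\ u 1 t = 0 /\ v 0 t = 0 /\ v 1 t = 0).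

Definition beam_regularity (u1 : R -> R) (T : R) (u : R -> R -> R) (Q : R)
    : Prop :=
  0 < Q /\
  (exists w, is_dt T 4 u w /\
     forall x t, 0 <= x <= 1 -> 0 <= t <= T -> Rabs (w x t) <= Q) /\
  (exists v w, is_dx T 2 u v /\ is_dt T 3 v w /\
     forall x t, 0 <= x <= 1 -> 0 <= t <= T -> Rabs (w x t) <= Q) /\
  (exists w, is_dx T 6 u w /\
     forall x t, 0 <= x <= 1 -> 0 <= t <= T -> Rabs (w x t) <= Q) /\
  (exists w, nth_deriv_on (itv 0 1) 4 u1 w /\
     forall x, 0 <= x <= 1 -> Rabs (w x) <= Q).

(* [u2] is the second time derivative of [u] at [t = 0], together with its
   expression through the data. *)
Definition initial_acceleration (P : R -> R) (f : R -> R -> R) (u0 u1 : R -> R)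
    (T : R) (u : R -> R -> R) (u2 : R -> R) : Prop :=
  exists (utt v : R -> R -> R) (d4u0 : R -> R),
    is_dt T 2 u utt /\ is_dx T 2 u v /\ nth_deriv_on (itv 0 1) 4 u0 d4u0 /\
    forall x, 0 <= x <= 1 ->
      u2 x = utt x 0 /\ u2 x = - qhat P v 0 * u1 x - d4u0 x + f x 0.

(* Grid functions are [nat -> R], of which only the values at [0 <= j <= 2J]
   matter; time-dependent ones are [nat -> nat -> R], time level first. *)

Definition mesh (J : nat) : R := 1 / (2 * INR J).
Definition node (J j : nat) : R := INR j * mesh J.
Definition tau (T : R) (N : nat) : R := T / INR (N + 1).
Definition time (T : R) (N n : nat) : R := INR n * tau T N.

(* Only used for [1 <= j]. *)
Definition dxx (J : nat) (U : nat -> R) (j : nat) : R :=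
  (U (j + 1)%nat - 2 * U j + U (j - 1)%nat) / mesh J ^ 2.

Definition calA (J : nat) (U : nat -> R) (j : nat) : R :=
  if andb (1 <=? j)%nat (j <=? 2 * J - 1)%nat
  then / 12 * (U (j + 1)%nat + 10 * U j + U (j - 1)%nat)
  else U j.

(* Level [n - 1] is truncated; the four operators below are only used for
   [1 <= n]. *)
Definition dt1 (k : R) (U : nat -> nat -> R) (n j : nat) : R :=
  (U n j - U (n - 1)%nat j) / k.
Definition dt2 (k : R) (U : nat -> nat -> R) (n j : nat) : R :=
  (U (n + 1)%nat j - 2 * U n j + U (n - 1)%nat j) / k ^ 2.
Definition dtbar (k : R) (U : nat -> nat -> R) (n j : nat) : R :=
  (U (n + 1)%nat j - U (n - 1)%nat j) / (2 * k).
Definition ttilde (U : nat -> nat -> R) (n j : nat) : R :=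
  (U (n + 1)%nat j + U (n - 1)%nat j) / 2.

(* Squared norms. *)
Definition norm2 (J : nat) (Q : nat -> R) : R :=
  mesh J * sum_n_m (fun j => Q j ^ 2) 1 (2 * J - 1).
Definition norm2_A (J : nat) (Q : nat -> R) : R :=
  2 * mesh J * sum_n_m (fun j => Q (2 * j - 1)%nat ^ 2) 1 J.
Definition norm2_B (J : nat) (Q : nat -> R) : R :=
  2 / 3 * norm2 J Q + / 3 * norm2_A J Q.

Record compact_scheme (P : R -> R) (f : R -> R -> R) (u0 u1 u2 : R -> R)
    (T : R) (J N : nat) (U V : nat -> nat -> R) : Prop := {
  scheme_U : forall n j, (1 <= n <= N)%nat -> (1 <= j <= 2 * J - 1)%nat ->
    calA J (dt2 (tau T N) U n) j
    + P (norm2_B J (V n)) * calA J (dtbar (tau T N) U n) j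
    + dxx J (ttilde V n) j
    = calA J (fun i => f (node J i) (time T N n)) j;
  scheme_V : forall n j, (1 <= n <= N)%nat -> (1 <= j <= 2 * J - 1)%nat ->
    calA J (dtbar (tau T N) V n) j = dxx J (dtbar (tau T N) U n) j;
  scheme_bc : forall n, (0 <= n <= N + 1)%nat ->
    U n 0%nat = 0 /\ U n (2 * J)%nat = 0 /\
    V n 0%nat = 0 /\ V n (2 * J)%nat = 0;
  scheme_U0 : forall j, (1 <= j <= 2 * J - 1)%nat -> U 0%nat j = u0 (node J j);
  scheme_U1 : forall j, (1 <= j <= 2 * J - 1)%nat ->
    dt1 (tau T N) U 1 j = u1 (node J j) + tau T N / 2 * u2 (node J j);
  scheme_V0 : exists d2 : R -> R,
    nth_deriv_on (itv 0 1) 2 u0 d2 /\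
    forall j, (1 <= j <= 2 * J - 1)%nat -> V 0%nat j = d2 (node J j);
  scheme_V1 : exists d2 : R -> R,
    nth_deriv_on (itv 0 1) 2
      (fun x => u0 x + tau T N * u1 x + tau T N ^ 2 / 2 * u2 x) d2 /\
    forall j, (1 <= j <= 2 * J - 1)%nat -> V 1%nat j = d2 (node J j)
}.

Definition energy (T : R) (J N : nat) (U V : nat -> nat -> R) (n : nat) : R :=
  sqrt (norm2 J (calA J (dt1 (tau T N) U (n + 1)%nat))
        + / 2 * (norm2 J (calA J (V (n + 1)%nat)) + norm2 J (calA J (V n)))).

(* Main.v *)
Require Import Defs.
From Stdlib Require Import Reals Arith Lra Lia.
From Coquelicot Require Import Coquelicot.

Open Scope R_scope.

(** The scheme is tested with the averaged velocity [calA J (dtbar k U n)]. The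
    acceleration term and the velocity are, up to factors, the difference and
    the sum of two consecutive values of [calA J (dt1 k U _)], so their product
    is a difference of squares. The damping term becomes a square times [P],
    hence has a sign. The remaining term pairs [dxx] of the averaged [V] with
    [calA] of the velocity. Since [calA] is the identity plus [h^2 / 12] times
    [dxx], and [dxx] is symmetric on grid functions that vanish at both ends,
    [dxx] and [calA] may be exchanged under the sum ([dxx_calA_exchange]); the
    second equation of the scheme then turns [dxx] of the velocity into
    [calA J (dtbar k V n)], and again a difference of squares appears.
    Altogether, with zero forcing, the squared energy decreases by [2 k P] times
    the squared norm of the tested velocity at each step ([energy2_step]). *)

Lemma calA_interior (J : nat) (X : nat -> R) (j : nat) :
  (1 <= j <= 2 * J - 1)%nat ->
  calA J X j = / 12 * (X (j + 1)%nat + 10 * X j + X (j - 1)%nat).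
Proof.
  intros [H1 H2]. unfold calA.
  apply Nat.leb_le in H1. apply Nat.leb_le in H2. now rewrite H1, H2.
Qed.

Lemma mesh_pos (J : nat) : (0 < J)%nat -> 0 < mesh J.
Proof.
  intros HJ. unfold mesh. apply lt_0_INR in HJ.
  apply Rdiv_lt_0_compat; lra.
Qed.

Lemma tau_pos (T : R) (N : nat) : 0 < T -> 0 < tau T N.
Proof.
  intros HT. apply Rdiv_lt_0_compat; [exact HT | apply lt_0_INR; lia].
Qed.

Lemma node_itv (J j : nat) :
  (0 < J)%nat -> (j <= 2 * J)%nat -> 0 <= node J j <= 1.
Proof.
  intros HJ Hj. unfold node.
  assert (Hm := mesh_pos J HJ).
  assert (Hj0 := pos_INR j).
  apply le_INR in Hj. rewrite mult_INR in Hj. simpl (INR 2) in Hj.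
  assert (E : 2 * INR J * mesh J = 1).
  { unfold mesh. field. apply lt_0_INR in HJ. lra. }
  split; [apply Rmult_le_pos; lra |].
  rewrite <- E. apply Rmult_le_compat_r; lra.
Qed.

Lemma time_itv (T : R) (N n : nat) :
  0 < T -> (1 <= n <= N)%nat -> 0 < time T N n <= T.
Proof.
  intros HT [Hn HnN]. unfold time.
  assert (Ht := tau_pos T N HT).
  assert (E : INR (N + 1) * tau T N = T).
  { unfold tau. field. apply not_0_INR. lia. }
  split.
  - apply Rmult_lt_0_compat; [apply lt_0_INR; lia | exact Ht].
  - rewrite <- E at 2. apply Rmult_le_compat_r; [lra | apply le_INR; lia].
Qed.

Lemma sum_n_m_nonneg (F : nat -> R) (a b : nat) :
  (forall j, 0 <= F j) -> 0 <= sum_n_m F a b.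
Proof.
  intros HF.
  apply Rle_trans with (sum_n_m (fun _ => zero) a b : R).
  - rewrite sum_n_m_const_zero. apply Rle_refl.
  - apply sum_n_m_le. exact HF.
Qed.

Lemma norm2_nonneg (J : nat) (X : nat -> R) : (0 < J)%nat -> 0 <= norm2 J X.
Proof.
  intros HJ. apply Rmult_le_pos; [apply Rlt_le, mesh_pos, HJ |].
  apply sum_n_m_nonneg. intros j. apply pow2_ge_0.
Qed.

Lemma norm2_B_nonneg (J : nat) (X : nat -> R) : (0 < J)%nat -> 0 <= norm2_B J X.
Proof.
  intros HJ. unfold norm2_B.
  assert (H := norm2_nonneg J X HJ).
  assert (HA : 0 <= norm2_A J X).
  { apply Rmult_le_pos.
    - assert (Hm := mesh_pos J HJ). lra.
    - apply sum_n_m_nonneg. intros j. apply pow2_ge_0. }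
  lra.
Qed.

Lemma sum_n_m_telescope (w : nat -> R) (m : nat) :
  sum_n_m (fun j => w j - w (j - 1)%nat) 1 m = w m - w 0%nat.
Proof.
  induction m as [|m IH].
  - rewrite sum_n_m_zero by lia. unfold zero; simpl. lra.
  - rewrite sum_n_Sm by lia. rewrite IH.
    replace (S m - 1)%nat with m by lia. unfold plus; simpl. lra.
Qed.

(** The [h^2 / 12] parts of the two copies of [calA] give [dxx X * dxx Y] on
    both sides and cancel, leaving the commutator of [dxx], which is a
    difference of the discrete Wronskian [X (j + 1) * Y j - X j * Y (j + 1)]. *)
Lemma dxx_calA_commutator (J : nat) (X Y : nat -> R) (j : nat) :
  (0 < J)%nat -> (1 <= j <= 2 * J - 1)%nat ->
  let w i := X (i + 1)%nat * Y i - X i * Y (i + 1)%nat in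
  dxx J X j * calA J Y j - calA J X j * dxx J Y j
  = / mesh J ^ 2 * (w j - w (j - 1)%nat).
Proof.
  intros HJ Hj w. unfold w, dxx. rewrite !calA_interior by exact Hj.
  replace (j - 1 + 1)%nat with j by lia.
  assert (Hm := mesh_pos J HJ). field. lra.
Qed.

(** Summation by parts: the Wronskian vanishes at both ends of the grid. *)
Lemma dxx_calA_exchange (J : nat) (X Y : nat -> R) :
  (0 < J)%nat -> X 0%nat = 0 -> X (2 * J)%nat = 0 ->
  Y 0%nat = 0 -> Y (2 * J)%nat = 0 ->
  sum_n_m (fun j => dxx J X j * calA J Y j - calA J X j * dxx J Y j)
    1 (2 * J - 1) = 0.
Proof.
  intros HJ HX0 HX1 HY0 HY1.
  set (w i := X (i + 1)%nat * Y i - X i * Y (i + 1)%nat).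
  rewrite (sum_n_m_ext_loc _ (fun j => mult (/ mesh J ^ 2) (w j - w (j - 1)%nat))).
  2:{ intros j Hj. exact (dxx_calA_commutator J X Y j HJ Hj). }
  rewrite sum_n_m_mult_l, sum_n_m_telescope. unfold w.
  replace (2 * J - 1 + 1)%nat with (2 * J)%nat by lia.
  rewrite HX0, HX1, HY0, HY1. unfold mult; simpl. ring.
Qed.

Definition energy2 (k : R) (J : nat) (U V : nat -> nat -> R) (n : nat) : R :=
  norm2 J (calA J (dt1 k U (n + 1)%nat))
  + / 2 * (norm2 J (calA J (V (n + 1)%nat)) + norm2 J (calA J (V n))).

Definition energy2_density (k : R) (J : nat) (U V : nat -> nat -> R)
    (n j : nat) : R :=
  calA J (dt1 k U (n + 1)%nat) j ^ 2
  + / 2 * (calA J (V (n + 1)%nat) j ^ 2 + calA J (V n) j ^ 2).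

Lemma energy2_sum (k : R) (J : nat) (U V : nat -> nat -> R) (n : nat) :
  energy2 k J U V n
  = mesh J * sum_n_m (energy2_density k J U V n) 1 (2 * J - 1).
Proof.
  unfold energy2, norm2, energy2_density.
  rewrite (sum_n_m_plus (fun j => calA J (dt1 k U (n + 1)%nat) j ^ 2)
    (fun j => / 2 * (calA J (V (n + 1)%nat) j ^ 2 + calA J (V n) j ^ 2))).
  rewrite (sum_n_m_mult_l (/ 2)
    (fun j => calA J (V (n + 1)%nat) j ^ 2 + calA J (V n) j ^ 2)).
  rewrite (sum_n_m_plus (fun j => calA J (V (n + 1)%nat) j ^ 2)).
  unfold plus, mult; simpl. ring.
Qed.

(** The first equation of the scheme multiplied by [2 k] times the averaged
    velocity. Only the mismatch in the position of [dxx] and [calA] keeps the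
    energy balance from holding at each node; [c] is the damping coefficient. *)
Lemma energy2_density_step (k : R) (J : nat) (U V : nat -> nat -> R) (c : R)
    (n j : nat) :
  k <> 0 -> (1 <= n)%nat -> (1 <= j <= 2 * J - 1)%nat ->
  calA J (dt2 k U n) j + c * calA J (dtbar k U n) j + dxx J (ttilde V n) j = 0 ->
  calA J (dtbar k V n) j = dxx J (dtbar k U n) j ->
  energy2_density k J U V (n - 1) j - energy2_density k J U V n j
  = 2 * k * c * calA J (dtbar k U n) j ^ 2
    + 2 * k * (dxx J (ttilde V n) j * calA J (dtbar k U n) j
               - calA J (ttilde V n) j * dxx J (dtbar k U n) j).
Proof.
  intros Hk Hn Hj EU EV. unfold energy2_density.
  replace (n - 1 + 1)%nat with n by lia.
  assert (Hacc : calA J (dt2 k U n) j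
    = / k * (calA J (dt1 k U (n + 1)%nat) j - calA J (dt1 k U n) j)).
  { rewrite !calA_interior by exact Hj. unfold dt2, dt1.
    replace (n + 1 - 1)%nat with n by lia. field. exact Hk. }
  assert (Hvel : calA J (dtbar k U n) j
    = / 2 * (calA J (dt1 k U (n + 1)%nat) j + calA J (dt1 k U n) j)).
  { rewrite !calA_interior by exact Hj. unfold dtbar, dt1.
    replace (n + 1 - 1)%nat with n by lia. field. exact Hk. }
  assert (HVbar : calA J (dtbar k V n) j
    = / (2 * k) * (calA J (V (n + 1)%nat) j - calA J (V (n - 1)%nat) j)).
  { rewrite !calA_interior by exact Hj. unfold dtbar. field. exact Hk. }
  assert (HVt : calA J (ttilde V n) j
    = / 2 * (calA J (V (n + 1)%nat) j + calA J (V (n - 1)%nat) j)).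
  { rewrite !calA_interior by exact Hj. unfold ttilde. field. }
  rewrite <- EV.
  replace (dxx J (ttilde V n) j)
    with (- calA J (dt2 k U n) j - c * calA J (dtbar k U n) j) by lra.
  rewrite Hacc, Hvel, HVbar, HVt. field. exact Hk.
Qed.

Lemma energy2_step (k : R) (J : nat) (U V : nat -> nat -> R) (c : R) (n : nat) :
  (0 < J)%nat -> k <> 0 -> (1 <= n)%nat ->
  (forall m, (m <= n + 1)%nat ->
     U m 0%nat = 0 /\ U m (2 * J)%nat = 0 /\
     V m 0%nat = 0 /\ V m (2 * J)%nat = 0) ->
  (forall j, (1 <= j <= 2 * J - 1)%nat ->
     calA J (dt2 k U n) j + c * calA J (dtbar k U n) j
     + dxx J (ttilde V n) j = 0) ->
  (forall j, (1 <= j <= 2 * J - 1)%nat ->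
     calA J (dtbar k V n) j = dxx J (dtbar k U n) j) ->
  energy2 k J U V (n - 1) - energy2 k J U V n
  = 2 * k * c * norm2 J (calA J (dtbar k U n)).
Proof.
  intros HJ Hk Hn Hbc EU EV.
  destruct (Hbc (n + 1)%nat) as (HU0 & HU1 & HV0 & HV1); [lia |].
  destruct (Hbc (n - 1)%nat) as (HU0' & HU1' & HV0' & HV1'); [lia |].
  set (comm j := dxx J (ttilde V n) j * calA J (dtbar k U n) j
                 - calA J (ttilde V n) j * dxx J (dtbar k U n) j).
  assert (Hcomm : sum_n_m comm 1 (2 * J - 1) = 0).
  { apply dxx_calA_exchange; [exact HJ | unfold ttilde | unfold ttilde
      | unfold dtbar | unfold dtbar];
    rewrite ?HU0, ?HU1, ?HV0, ?HV1, ?HU0', ?HU1', ?HV0', ?HV1'; lra. }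
  set (D j := mult (2 * k * c) (calA J (dtbar k U n) j ^ 2)).
  set (C j := mult (2 * k) (comm j)).
  assert (Hsum : sum_n_m (energy2_density k J U V (n - 1)) 1 (2 * J - 1)
    = sum_n_m (energy2_density k J U V n) 1 (2 * J - 1)
      + (sum_n_m D 1 (2 * J - 1) + sum_n_m C 1 (2 * J - 1))).
  { rewrite <- (sum_n_m_plus D C), <- (sum_n_m_plus (energy2_density k J U V n)).
    apply sum_n_m_ext_loc. intros j Hj.
    assert (E := energy2_density_step k J U V c n j Hk Hn Hj (EU j Hj) (EV j Hj)).
    unfold D, C, comm, plus, mult; simpl in *. lra. }
  rewrite !energy2_sum, Hsum. unfold D, C, norm2.
  rewrite (sum_n_m_mult_l (2 * k * c) (fun j => calA J (dtbar k U n) j ^ 2)),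
    (sum_n_m_mult_l (2 * k) comm).
  change (mesh J * (sum_n_m (energy2_density k J U V n) 1 (2 * J - 1)
    + (2 * k * c * sum_n_m (fun j => calA J (dtbar k U n) j ^ 2) 1 (2 * J - 1)
       + 2 * k * sum_n_m comm 1 (2 * J - 1)))
    - mesh J * sum_n_m (energy2_density k J U V n) 1 (2 * J - 1)
    = 2 * k * c
      * (mesh J * sum_n_m (fun j => calA J (dtbar k U n) j ^ 2) 1 (2 * J - 1))).
  rewrite Hcomm. ring.
Qed.

Theorem corollary3p1p1
  (P : R -> R) (QP p0 p1 L : R) (hP : damping_assumptions P QP p0 p1 L)
  (T : R) (hT : 0 < T)
  (f : R -> R -> R) (u0 u1 : R -> R)
  (hf : forall x t, 0 <= x <= 1 -> 0 < t <= T -> f x t = 0)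
  (u : R -> R -> R) (hu : beam_solution P f u0 u1 T u)
  (Qu : R) (hreg : beam_regularity u1 T u Qu)
  (u2 : R -> R) (hu2 : initial_acceleration P f u0 u1 T u u2)
  (J N : nat) (hJ : (0 < J)%nat)
  (U V : nat -> nat -> R) (hUV : compact_scheme P f u0 u1 u2 T J N U V) :
  forall n : nat, (1 <= n <= N)%nat ->
    0 <= energy T J N U V n /\ energy T J N U V n <= energy T J N U V 0.
Proof.
  destruct hP as (_ & _ & _ & Ppos & _).
  assert (Ht := tau_pos T N hT).
  assert (Hdec : forall n, (n <= N)%nat ->
    energy2 (tau T N) J U V n <= energy2 (tau T N) J U V 0).
  { induction n as [|n IH]; intros Hn; [apply Rle_refl |].
    apply Rle_trans with (2 := IH ltac:(lia)).
    assert (Hstep := energy2_step (tau T N) J U V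
      (P (norm2_B J (V (S n)))) (S n) hJ ltac:(lra) ltac:(lia)).
    replace (S n - 1)%nat with n in Hstep by lia.
    assert (HP := Ppos _ (norm2_B_nonneg J (V (S n)) hJ)).
    assert (Hnorm := norm2_nonneg J (calA J (dtbar (tau T N) U (S n))) hJ).
    assert (Hdiss : 0 <= 2 * tau T N * P (norm2_B J (V (S n)))
      * norm2 J (calA J (dtbar (tau T N) U (S n)))).
    { apply Rmult_le_pos; [apply Rmult_le_pos |]; lra. }
    rewrite <- Hstep in Hdiss; [lra | | | ].
    - intros m Hm. apply (scheme_bc _ _ _ _ _ _ _ _ _ _ hUV). lia.
    - intros j Hj.
      rewrite (scheme_U _ _ _ _ _ _ _ _ _ _ hUV) by lia.
      rewrite calA_interior by exact Hj.
      rewrite !hf; try (apply node_itv; lia); try (apply time_itv; [exact hT | lia]).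
      lra.
    - intros j Hj. apply (scheme_V _ _ _ _ _ _ _ _ _ _ hUV); lia. }
  intros n Hn. split; [apply sqrt_pos |].
  apply sqrt_le_1_alt, Hdec. lia.
Qed.
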